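(* Let $P(\rho)=K\rho^\gamma$ with $K>0$ and $\gamma>\frac43$, and let $m>0$. Let $\rho_m\in mR(\mathbb{R}^3)$ with $U(\rho_m)<\infty$. Then $E_0$ is $P_\infty(\rho_m)$-differentiable at $\rho_m$, and its derivative at $\rho_m$ satisfies $$E_0'(\rho_m)(x)=A^{-(\gamma-1)}E_0'(\rho)\!\left(\frac{x}{B}\right)=m^{\frac{2\gamma-2}{3\gamma-4}}\,E_0'(\rho)\!\left(\frac1B x\right),$$ where $A=m^{-\frac{2}{3\gamma-4}}$, $B=m^{\frac{\gamma-2}{3\gamma-4}}$, and $\rho(x):=A\,\rho_m(Bx)$, which belongs to $R(\mathbb{R}^3)$ (so has mass $1$) and satisfies $U(\rho)<\infty$.
   Context: For $m>0$, $mR(\mathbb{R}^3):=\{\rho\in L^{4/3}(\mathbb{R}^3): \rho\ge0,\ \int_{\mathbb{R}^3}\rho\,dx=m\}$, and $R(\mathbb{R}^3)$ is the case $m=1$. $U(\rho)=\int_{\mathbb{R}^3}\frac{K}{\gamma-1}\rho^\gamma\,dx$, $G(\rho,\rho)=\iint_{\mathbb{R}^3\times\mathbb{R}^3}\frac{\rho(x)\rho(y)}{|x-y|}\,dx\,dy$, $E_0(\rho)=U(\rho)-\frac12G(\rho,\rho)$ (defined by the same formula for nonnegative densities of any mass), and $V_\rho(x)=\int_{\mathbb{R}^3}\frac{\rho(y)}{|x-y|}\,dy$. Perturbation set: $P_\infty(\rho):=\bigcup_{R<\infty}P_R(\rho)$, where $P_R(\rho)$ is the set of $\tau\in L^\infty(\mathbb{R}^3)$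 such that $\tau(x)=0$ wherever $\rho(x)>R$ or $|x|>R$, and $\tau(x)\ge0$ wherever $\rho(x)<R^{-1}$. $E_0$ is $P_\infty(\rho)$-differentiable at $\rho$ with derivative the function $E_0'(\rho)$ if for every $\tau\in P_\infty(\rho)$, $\lim_{t\to0^+}\frac{E_0(\rho+t\tau)-E_0(\rho)}{t}=\int_{\mathbb{R}^3}E_0'(\rho)\,\tau\,dx$. When $U(\rho)<\infty$, the function is $E_0'(\rho)(x)=\frac{K\gamma}{\gamma-1}\rho(x)^{\gamma-1}-V_\rho(x)$ (a.e. equality of functions is understood). *)

(* Defs.v *)
From HB Require Import structures.
From mathcomp Require Import all_boot all_order all_algebra.
From mathcomp Require Import all_classical all_reals all_analysis.

Set Implicit Arguments.
Unset Strict Implicit.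
Unset Printing Implicit Defensive.

Import Order.TTheory GRing.Theory Num.Theory.
Import numFieldNormedType.Exports.

Local Open Scope classical_set_scope.
Local Open Scope ring_scope.

(* Points of the Euclidean space are triples ((x1, x2), x3), so that Borel sets
   and Lebesgue measure are the library's products. *)
Notation R3 R :=
  (measurableTypeR R * measurableTypeR R * measurableTypeR R)%type.

(* Product measures of sigma-finite measures are not inferred to be sigma-finite
   by the library (its canonical instance only covers subprobabilities), hence
   the explicit instances. *)
Lemma sigma_finite_prod d1 d2 (T1 : measurableType d1) (T2 : measurableType d2)
    (R : realType) (m1 : {sigma_finite_measure set T1 -> \bar R})
    (m2 : {sigma_finite_measure set T2 -> \bar R}) :
  sigma_finite setT (m1 \x m2)%E.
Proof.
have /sigma_finiteP[F [TF ndF Foo]] := sigma_finiteT m1.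
have /sigma_finiteP[G [TG ndG Goo]] := sigma_finiteT m2.
exists (fun n => F n `*` G n).
  rewrite -setXTT TF TG predeqE => -[x y]; split.
    move=> [/= [n _ Fnx] [k _ Gky]]; exists (maxn n k) => //; split.
    - by move: x Fnx; exact/subsetPset/ndF/leq_maxl.
    - by move: y Gky; exact/subsetPset/ndG/leq_maxr.
  by move=> [n _ []/= ? ?]; split; exists n.
move=> k; have [? ?] := Foo k; have [? ?] := Goo k.
split; first exact: measurableX.
by rewrite product_measure1E// lte_mul_pinfty// ge0_fin_numE.
Qed.

Definition leb2 (R : realType) :
    set (measurableTypeR R * measurableTypeR R)%type -> \bar R :=
  (@lebesgue_measure R \x @lebesgue_measure R)%E.
HB.instance Definition _ (R : realType) := Measure.on (@leb2 R).
HB.instance Definition _ (R : realType) :=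
  @Measure_isSigmaFinite.Build _ _ _ (@leb2 R)
    (sigma_finite_prod (@lebesgue_measure R) (@lebesgue_measure R)).

Definition leb3 (R : realType) : set (R3 R) -> \bar R :=
  (@leb2 R \x @lebesgue_measure R)%E.
HB.instance Definition _ (R : realType) := Measure.on (@leb3 R).
HB.instance Definition _ (R : realType) :=
  @Measure_isSigmaFinite.Build _ _ _ (@leb3 R)
    (sigma_finite_prod (@leb2 R) (@lebesgue_measure R)).

(* The library's norm on a product is the maximum norm; this is the Euclidean
   one. *)
Definition enorm (R : realType) (x : R3 R) : R :=
  Num.sqrt ((x.1.1 : R) ^+ 2 + (x.1.2 : R) ^+ 2 + (x.2 : R) ^+ 2).

Definition sub3 (R : realType) (x y : R3 R) : R3 R :=
  (((x.1.1 : R) - (y.1.1 : R), (x.1.2 : R) - (y.1.2 : R)),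
   (x.2 : R) - (y.2 : R)).

Definition scale3 (R : realType) (b : R) (x : R3 R) : R3 R :=
  ((b * (x.1.1 : R), b * (x.1.2 : R)), b * (x.2 : R)).

(* Densities and perturbations are Borel representatives of classes of functions
   modulo Lebesgue-null sets, so every pointwise condition is imposed almost
   everywhere. *)
Definition massR (R : realType) (m : R) : set (R3 R -> R) :=
  [set rho | [/\ rho \in Lfun (@leb3 R) (4 / 3)%:E,
    {ae @leb3 R, forall x, 0 <= rho x} &
    (\int[@leb3 R]_x (rho x)%:E = m%:E)%E]].

Section Energy.
Context {R : realType}.
Implicit Types (rho tau : R3 R -> R) (K gamma : R).

Definition internal_energy K gamma rho : \bar R :=
  (\int[@leb3 R]_x (K / (gamma - 1) * rho x `^ gamma)%:E)%E.

(* The kernel is 0 instead of +oo on the diagonal x = y, a null set, since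
   0^-1 = 0; likewise in [potential]. *)
Definition grav_energy rho : \bar R :=
  (\int[(@leb3 R \x @leb3 R)]_z
     (rho z.1 * rho z.2 / enorm (sub3 z.1 z.2))%:E)%E.

Definition E0 K gamma rho : \bar R :=
  (internal_energy K gamma rho - 2^-1%:E * grav_energy rho)%E.

Definition potential rho (x : R3 R) : \bar R :=
  (\int[@leb3 R]_y (rho y / enorm (sub3 x y))%:E)%E.

Definition PR rho (r : R) : set (R3 R -> R) :=
  [set tau | [/\ tau \in Lfun (@leb3 R) +oo%E,
    {ae @leb3 R, forall x, r < rho x \/ r < enorm x -> tau x = 0} &
    {ae @leb3 R, forall x, rho x < r^-1 -> 0 <= tau x}]].

Definition Pinfty rho : set (R3 R -> R) :=
  \bigcup_(r in [set r : R | 0 < r]) PR rho r.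

(* The candidate derivative D may take infinite values, as [potential] may; the
   existence of the integral of D * tau is part of the definition.  Since the
   limit is then a finite number, both E0 rho and E0 (rho + t tau), for small
   t > 0, have to be finite: in \bar R, a difference x - y is finite only when
   both x and y are. *)
Definition is_Pinfty_derivative K gamma rho (D : R3 R -> \bar R) : Prop :=
  forall tau, Pinfty rho tau ->
    (@leb3 R).-integrable setT (fun x => D x * (tau x)%:E)%E /\
    ((t^-1)%:E * (E0 K gamma (fun x => rho x + t * tau x)%R - E0 K gamma rho))%E
      @[t --> 0^'+] --> (\int[@leb3 R]_x (D x * (tau x)%:E))%E.

Definition dE0 K gamma rho (x : R3 R) : \bar R :=
  ((K * gamma / (gamma - 1) * rho x `^ (gamma - 1))%:E - potential rho x)%E.

End Energy.

(* Main.v *)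
From HB Require Import structures.
Require Import Defs.
From mathcomp Require Import all_boot all_order all_algebra.
From mathcomp Require Import all_classical all_reals all_analysis.
From mathcomp Require Import measurable_realfun ess_sup_inf ring lra.

Import Order.TTheory GRing.Theory Num.Theory.
Import numFieldNormedType.Exports.
Local Open Scope classical_set_scope.
Local Open Scope ring_scope.

(** Why the statement holds.

    Differentiability.  Let tau be an admissible perturbation: bounded by some
    M, supported in a ball of radius r, vanishing where rho > r and
    nonnegative where rho < 1/r.  For small t > 0 the function rho + t tau is
    then nonnegative, and on the support of tau both rho and rho + t tau lie in
    [0, r + M], where s |-> s^gamma is Lipschitz because gamma > 1.  Hence the
    difference quotients of rho^gamma are dominated by a multiple of the
    indicator of a cube, and they converge pointwise to
    gamma rho^(gamma - 1) tau; the sign condition on tau takes care of the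
    points where rho = 0.  Dominated convergence gives the derivative of the
    internal energy ([internal_derivative]).

    The gravitational energy is a quadratic form, so along rho + t tau it is a
    polynomial of degree 2 in t ([grav_energy_perturb]) once the bilinear form
    is finite.  Its finiteness on L^1 and L^(4/3) is the analytic core
    ([pair_integrable]).  It is a form of Young's inequality with exponents
    4/3, 4/3 and 2, obtained from a pointwise arithmetic-geometric inequality
    ([newton_young]) which bounds f(x) g(y) / |x - y| by a sum of functions
    integrable by Tonelli; what is needed of the kernel is that its square is
    integrable near the diagonal, uniformly ([integral_near_newton_sq]), which
    is seen by comparing it with indicators of cubes of side 2^(1-n).  The
    linear coefficient is twice the integral of V_rho tau by Fubini
    ([potential_mul_integrable]).

    Scaling.  Dilations multiply Lebesgue measure on R^3 by the cube of the
    ratio ([leb3_dilates]), so that V scales by A B^-2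
    ([potential_scale3]).  The exponents of A and B are the solution of the
    two equations A B^-3 m = 1 (unit mass, [mass_exponent]) and
    A^(2 - gamma) = B^2 (rho^(gamma - 1) and V scale alike,
    [potential_exponent]); gamma <> 4/3 makes that system solvable. *)

Set Implicit Arguments.
Unset Strict Implicit.
Unset Printing Implicit Defensive.

(** * The Newtonian kernel and its square near the diagonal *)

Section Kernel.
Context {R : realType}.
Implicit Types (x y : R3 R) (r : R).

Definition cube x r : set (R3 R) :=
  (`[(x.1.1 : R) - r, (x.1.1 : R) + r] `*`
   `[(x.1.2 : R) - r, (x.1.2 : R) + r]) `*`
   `[(x.2 : R) - r, (x.2 : R) + r].

Lemma measurable_cube x r : measurable (cube x r).
Proof. by apply: measurableX; [apply: measurableX|]; exact: measurable_itv. Qed.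

Lemma lebesgue_measure_interval (a r : R) : 0 <= r ->
  lebesgue_measure (`[a - r, a + r] : set R) = (2 * r)%:E.
Proof.
move=> r0; rewrite lebesgue_measure_itv/= lte_fin; case: ltP => [_|h].
  by rewrite -EFinD; congr (_%:E); lra.
by congr (_%:E); lra.
Qed.

(** The integrals of the kernel are estimated through cubes, since their
    measure can be read off the product structure. *)
Lemma leb3_cube x r : 0 <= r -> leb3 (cube x r) = (8 * r ^+ 3)%:E.
Proof.
move=> r0; rewrite /leb3 /cube product_measure1E//; last first.
  by apply: measurableX; exact: measurable_itv.
rewrite /= /leb2 product_measure1E//; do ?exact: measurable_itv.
transitivity ((2 * r)%:E * (2 * r)%:E * (2 * r)%:E)%E.
  by congr (_ * _ * _)%E; exact: lebesgue_measure_interval.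
by rewrite -!EFinM; congr (_%:E); ring.
Qed.

Lemma enorm_ge0 x : 0 <= enorm x. Proof. exact: sqrtr_ge0. Qed.

Lemma enorm_sub3C x y : enorm (sub3 x y) = enorm (sub3 y x).
Proof. by rewrite /enorm /sub3/=; congr Num.sqrt; ring. Qed.

Lemma coord_le_enorm x : [/\ `|x.1.1 : R| <= enorm x,
  `|x.1.2 : R| <= enorm x & `|x.2 : R| <= enorm x].
Proof.
have h (a s : R) : a ^+ 2 <= s -> `|a| <= Num.sqrt s.
  by move=> las; rewrite -sqrtr_sqr ler_wsqrtr.
have := sqr_ge0 (x.1.1 : R); have := sqr_ge0 (x.1.2 : R).
have := sqr_ge0 (x.2 : R).
by move=> *; split; apply: h; lra.
Qed.

Lemma enorm_sub3_cube x y r : enorm (sub3 x y) <= r -> cube x r y.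
Proof.
move=> xyr; have [] := coord_le_enorm (sub3 x y).
rewrite /sub3/=; do 3 (move=> /le_trans/(_ xyr); rewrite ler_norml =>
  /andP[? ?]).
by rewrite /cube/=; do ?split; rewrite in_itv/=; apply/andP; split; lra.
Qed.

Lemma measurable_coords d (T : measurableType d) (f : T -> R3 R) :
  measurable_fun setT f ->
  [/\ measurable_fun setT (fun t => (f t).1.1 : R),
   measurable_fun setT (fun t => (f t).1.2 : R) &
   measurable_fun setT (fun t => (f t).2 : R)].
Proof.
move=> mf.
have m1 := measurableT_comp measurable_fst mf.
split; [exact: measurableT_comp measurable_fst m1|
  exact: measurableT_comp measurable_snd m1|
  exact: measurableT_comp measurable_snd mf].
Qed.

Lemma measurable_enorm d (T : measurableType d) (f : T -> R3 R) :
  measurable_fun setT f -> measurable_fun setT (fun t => enorm (f t)).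
Proof.
move=> /measurable_coords[m1 m2 m3].
rewrite /enorm; under eq_fun.
  move=> t; rewrite -powR12_sqrt; first over.
  by rewrite !addr_ge0 ?sqr_ge0.
apply: (measurableT_comp (measurable_powR _)).
by apply: measurable_funD; [apply: measurable_funD|]; exact: measurable_funX.
Qed.

Lemma measurable_sub3 d (T : measurableType d) (f g : T -> R3 R) :
  measurable_fun setT f -> measurable_fun setT g ->
  measurable_fun setT (fun t => sub3 (f t) (g t)).
Proof.
move=> /measurable_coords[f1 f2 f3] /measurable_coords[g1 g2 g3].
by apply: measurable_fun_pair; [apply: measurable_fun_pair|];
  exact: measurable_funB.
Qed.

Definition newton x y : R := (enorm (sub3 x y))^-1.

Lemma newton_ge0 x y : 0 <= newton x y.
Proof. by rewrite invr_ge0 enorm_ge0. Qed.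

Lemma newtonC x y : newton x y = newton y x.
Proof. by rewrite /newton enorm_sub3C. Qed.

Lemma measurable_newton d (T : measurableType d) (f g : T -> R3 R) :
  measurable_fun setT f -> measurable_fun setT g ->
  measurable_fun setT (fun t => newton (f t) (g t)).
Proof.
move=> mf mg; rewrite /newton; under eq_fun do
  rewrite -powR_inv1 ?enorm_ge0//.
apply: (measurableT_comp (measurable_powR _)).
by apply: measurable_enorm; exact: measurable_sub3.
Qed.

(** Away from the diagonal the kernel is bounded by 1; only the square of the
    part within distance 1, singular of order 2 < 3, has to be integrated. *)
Definition near_newton_sq x y : R :=
  if enorm (sub3 x y) <= 1 then newton x y ^+ 2 else 0.

Lemma near_newton_sq_ge0 x y : 0 <= near_newton_sq x y.
Proof. by rewrite /near_newton_sq; case: ifP => // _; rewrite sqr_ge0. Qed.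

Lemma near_newton_sqC x y : near_newton_sq x y = near_newton_sq y x.
Proof. by rewrite /near_newton_sq enorm_sub3C newtonC. Qed.

Lemma measurable_near_newton_sq d (T : measurableType d) (f g : T -> R3 R) :
  measurable_fun setT f -> measurable_fun setT g ->
  measurable_fun setT (fun t => near_newton_sq (f t) (g t)).
Proof.
move=> mf mg; apply: measurable_fun_ifT => //.
  apply: measurable_fun_ler => //; apply: measurable_enorm.
  exact: measurable_sub3.
by apply: measurable_funX; exact: measurable_newton.
Qed.

Lemma dyadic_bracket (e : R) : 0 < e <= 1 ->
  exists n : nat, 2^-1 ^+ n.+1 < e <= 2^-1 ^+ n.
Proof.
move=> /andP[e0 e1].
have : exists n : nat, 2^-1 ^+ n.+1 < e.
  have /cvgrPdist_lt/(_ _ e0) : (fun n => (2^-1 : R) ^+ n) @ \oo --> (0 : R).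
    by apply: cvg_expr; rewrite ger0_norm// invf_lt1// ltr1n.
  move=> [N _ /(_ N.+1 (leqnSn N))]; rewrite /= sub0r normrN ger0_norm => [?|].
    by exists N.
  by rewrite exprn_ge0.
move=> ex; have [[|n] nP nmin] := ex_minnP ex.
  by exists 0%N; rewrite nP expr0.
exists n.+1; rewrite nP/= leNgt; apply/negP => /nmin.
by rewrite ltnn.
Qed.

(** Points at distance between 2^-(n+1) and 2^-n lie in the cube of half-side
    2^-n, and there the squared kernel is at most 4^(n+1): the n-th term of the
    series alone is large enough. *)
Lemma near_newton_sq_le_dyadic x y : ((near_newton_sq x y)%:E <=
  \sum_(0 <= n <oo) (4 ^+ n.+1 * \1_(cube x (2^-1 ^+ n)) y)%:E)%E.
Proof.
have t0 (n : nat) : (0 <= (4 ^+ n.+1 * \1_(cube x (2^-1 ^+ n)) y : R)%:E)%E.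
  by rewrite lee_fin mulr_ge0 ?exprn_ge0.
rewrite /near_newton_sq; case: ifPn => [e1|_]; last exact: nneseries_ge0.
have [e0|/eqP e0] := eqVneq (enorm (sub3 x y)) 0.
  by rewrite /newton e0 invr0 expr0n/=; exact: nneseries_ge0.
have {e0} : 0 < enorm (sub3 x y) by rewrite lt_def enorm_ge0 andbT; exact/eqP.
move=> e0; have [|n /andP[n1 n2]] := @dyadic_bracket (enorm (sub3 x y)).
  by rewrite e0.
apply: le_trans (nneseries_lim_ge n.+1 (fun n _ _ => t0 n)).
rewrite big_nat_recr//=.
apply: (@le_trans _ _ (4 ^+ n.+1 * \1_(cube x (2^-1 ^+ n)) y)%:E); last first.
  by rewrite leeDr// sume_ge0.
rewrite indicE mem_set; last exact: enorm_sub3_cube.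
rewrite mulr1 lee_fin /newton.
(* 4^(n+1) is the square of 2^(n+1), which bounds the kernel itself. *)
have -> : (4 : R) = 2 ^+ 2 by ring.
rewrite exprAC; apply: lerXn2r; rewrite ?nnegrE ?invr_ge0 ?exprn_ge0 ?ltW//.
by rewrite -[ltRHS]invrK ltf_pV2 ?posrE ?invr_gt0 ?exprn_gt0// -exprVn.
Qed.

(** Integrating the dyadic majorant term by term gives the geometric series
    of general term 4^(n+1) * 8 * 8^-n = 64 / 2^(n+1), uniformly in the
    centre. *)
Lemma integral_near_newton_sq x :
  (\int[@leb3 R]_y (near_newton_sq x y)%:E <= 64%:E)%E.
Proof.
pose t (n : nat) y : \bar R := (4 ^+ n.+1 * \1_(cube x (2^-1 ^+ n)) y)%:E.
have mt n : measurable_fun setT (t n).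
  apply/measurable_EFinP; apply: measurable_funM => //.
  by apply: measurable_indic; exact: measurable_cube.
have t0 n y : (0 <= t n y)%E by rewrite lee_fin mulr_ge0 ?exprn_ge0.
apply: (@le_trans _ _ (\int[@leb3 R]_y \sum_(0 <= n <oo) t n y)%E).
  apply: ge0_le_integral => //.
  - by move=> y _; rewrite lee_fin near_newton_sq_ge0.
  - by apply/measurable_EFinP; exact: measurable_near_newton_sq.
  - by apply: ge0_emeasurable_sum.
  - by move=> y _; exact: near_newton_sq_le_dyadic.
rewrite integral_nneseries//.
rewrite (_ : (fun n => _) =
    eseries (fun k : nat => (64 / (2 ^ (k + 1))%:R)%:E)).
  have := @cvg_geometric_eseries_half R 64 0.
  by rewrite expr0 divr1 => /cvg_lim -> //.
apply/funext => n; apply: eq_bigr => k _.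
rewrite /t; under eq_integral do rewrite EFinM.
rewrite ge0_integralZl ?lee_fin ?exprn_ge0//; last first.
  apply/measurable_EFinP; apply: measurable_indic; exact: measurable_cube.
rewrite integral_indic//; last exact: measurable_cube.
rewrite setIT.
transitivity ((4 ^+ k.+1)%:E * (8 * (2^-1 ^+ k) ^+ 3 : R)%:E)%E.
  by congr (_ * _)%E; apply: leb3_cube; rewrite exprn_ge0.
rewrite -EFinM; congr (_%:E).
rewrite natrX addn1 !exprS.
have -> : (4 : R) = 2 * 2 by ring.
rewrite exprMn !exprVn.
have : (2 : R) ^+ k != 0 by rewrite expf_neq0.
by move: (_ ^+ k) => u u0; field.
Qed.

End Kernel.

(** * Product integrability from a uniform bound on the sections *)

Section Schur.
Context d1 d2 (T1 : measurableType d1) (T2 : measurableType d2) {R : realType}.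
Variables (m1 : {sigma_finite_measure set T1 -> \bar R})
  (m2 : {sigma_finite_measure set T2 -> \bar R}).
Variables (k : T1 * T2 -> R) (C : R).
Hypotheses (mk : measurable_fun setT k) (k0 : forall z, 0 <= k z).

(** Tonelli with the inner integral over the second variable, where only k
    depends on it.  A function v of the second variable is a valid k, so that
    tensor products are covered as well. *)
Lemma integrable_fst_mul (u : T1 -> R) :
  (forall x, \int[m2]_y (k (x, y))%:E <= C%:E)%E ->
  (forall x, 0 <= u x) -> m1.-integrable setT (EFin \o u) ->
  (m1 \x m2)%E.-integrable setT (fun z => (u z.1 * k z)%:E).
Proof.
move=> kC u0 iu; have mu : measurable_fun setT u.
  exact/measurable_EFinP/(measurable_int _ iu).
have muk : measurable_fun setT (fun z => (u z.1 * k z)%:E).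
  apply/measurable_EFinP; apply: measurable_funM => //.
  exact: measurableT_comp mu measurable_fst.
have uk0 z : (0 <= (u z.1 * k z)%:E)%E by rewrite lee_fin mulr_ge0.
apply/integrableP; split => //.
under eq_integral do rewrite gee0_abs//.
rewrite fubini_tonelli1//.
apply: (@le_lt_trans _ _ (\int[m1]_x (C%:E * (u x)%:E))%E).
  apply: ge0_le_integral => //.
  - by move=> x _; apply: integral_ge0.
  - exact: measurable_fun_fubini_tonelli_F.
  - by apply/measurable_EFinP; exact: measurable_funM.
  move=> x _; rewrite /fubini_F/=; under eq_integral do rewrite EFinM.
  rewrite ge0_integralZl ?lee_fin//.
  - by rewrite muleC lee_pmul ?lee_fin//;
      apply: integral_ge0 => y _; rewrite lee_fin.
  - apply/measurable_EFinP; exact: measurable_fun_pair2.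
  - by move=> y _; rewrite lee_fin.
rewrite (_ : (\int[_]_x _)%E = (\int[m1]_x (C%:E * (EFin \o u) x))%E)//.
exact/integrable_lty/integrableZl.
Qed.

Lemma integrable_snd_mul (u : T2 -> R) :
  (forall y, \int[m1]_x (k (x, y))%:E <= C%:E)%E ->
  (forall y, 0 <= u y) -> m2.-integrable setT (EFin \o u) ->
  (m1 \x m2)%E.-integrable setT (fun z => (u z.2 * k z)%:E).
Proof.
move=> kC u0 iu; have mu : measurable_fun setT u.
  exact/measurable_EFinP/(measurable_int _ iu).
have muk : measurable_fun setT (fun z => (u z.2 * k z)%:E).
  apply/measurable_EFinP; apply: measurable_funM => //.
  exact: measurableT_comp mu measurable_snd.
have uk0 z : (0 <= (u z.2 * k z)%:E)%E by rewrite lee_fin mulr_ge0.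
apply/integrableP; split => //.
under eq_integral do rewrite gee0_abs//.
rewrite fubini_tonelli2//.
apply: (@le_lt_trans _ _ (\int[m2]_y (C%:E * (u y)%:E))%E).
  apply: ge0_le_integral => //.
  - by move=> x _; apply: integral_ge0.
  - exact: measurable_fun_fubini_tonelli_G.
  - by apply/measurable_EFinP; exact: measurable_funM.
  move=> y _; rewrite /fubini_G/=; under eq_integral do rewrite EFinM.
  rewrite ge0_integralZl ?lee_fin//.
  - by rewrite muleC lee_pmul ?lee_fin//;
      apply: integral_ge0 => x _; rewrite lee_fin.
  - apply/measurable_EFinP; exact: measurable_fun_pair1.
  - by move=> x _; rewrite lee_fin.
rewrite (_ : (\int[_]_x _)%E = (\int[m2]_x (C%:E * (EFin \o u) x))%E)//.
exact/integrable_lty/integrableZl.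
Qed.

End Schur.

(** * Finiteness of the interaction on L^1 and L^(4/3) *)

Section Pairs.
Context {R : realType}.
Implicit Types (x y : R3 R) (f g : R3 R -> R).

Definition L1L43 f := [/\ measurable_fun setT f,
  (@leb3 R).-integrable setT (fun x => `|f x|%:E) &
  (@leb3 R).-integrable setT (fun x => (`|f x| `^ (4 / 3))%:E)].

(** Within distance 1, put c = a^3, d = b^3 and w = 1 / |x - y|; then
    a^3 b^3 w <= a^4 b^4 + a^2 b^2 w^2 and a^2 b^2 <= a^4 + b^4.  Beyond that
    distance, w <= 1.  The exponents are those of Young's inequality for
    convolutions, 3/4 + 3/4 + 1/2 = 2. *)
Lemma newton_young (c d : R) x y : 0 <= c -> 0 <= d ->
  c * d * newton x y <= c * d + c `^ (4 / 3) * d `^ (4 / 3)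
    + c `^ (4 / 3) * near_newton_sq x y + d `^ (4 / 3) * near_newton_sq x y.
Proof.
move=> c0 d0.
have cube_root (s : R) : 0 <= s ->
    s = s `^ 3^-1 ^+ 3 /\ s `^ (4 / 3) = s `^ 3^-1 ^+ 4.
  move=> s0; rewrite -!powR_mulrn ?powR_ge0// -!powRrM.
  by rewrite mulVf// powRr1// mulrC.
have [cE ->] := cube_root _ c0; have [dE ->] := cube_root _ d0.
rewrite [in X in X * newton _ _]cE [in X in X * newton _ _]dE.
rewrite {}[in X in X * d]cE {}[in X in _ * X + _]dE.
have := powR_ge0 c 3^-1; have := powR_ge0 d 3^-1.
move: (c `^ 3^-1) (d `^ 3^-1) => a b b0 a0.
have a3b3 : 0 <= a ^+ 3 * b ^+ 3 by rewrite mulr_ge0 ?exprn_ge0.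
have a4b4 : 0 <= a ^+ 4 * b ^+ 4 by rewrite mulr_ge0 ?exprn_ge0.
rewrite /near_newton_sq; case: ifPn => [_|].
  have := newton_ge0 x y; move: (newton x y) => w w0.
  (* The two squares give the two inequalities above, with constants 1/2. *)
  have h1 : 0 <= (a ^+ 2 * b ^+ 2 - a * b * w) ^+ 2 by exact: sqr_ge0.
  have h2 : 0 <= (a ^+ 2 * w - b ^+ 2 * w) ^+ 2 by exact: sqr_ge0.
  have h3 : 0 <= a ^+ 4 * w ^+ 2 by rewrite mulr_ge0 ?exprn_ge0.
  have h4 : 0 <= b ^+ 4 * w ^+ 2 by rewrite mulr_ge0 ?exprn_ge0.
  nra.
rewrite -ltNge => e1; rewrite !mulr0 !addr0.
have w1 : newton x y <= 1 by rewrite invf_le1 ?ltW// (lt_trans _ e1).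
by rewrite (le_trans (ler_piMr _ w1))// lerDl.
Qed.

Lemma pair_integrable f g : L1L43 f -> L1L43 g ->
  (@leb3 R \x @leb3 R)%E.-integrable setT
    (fun z => (f z.1 * g z.2 * newton z.1 z.2)%:E).
Proof.
move=> [mf f1 f2] [mg g1 g2].
pose F x := `|f x| `^ (4 / 3); pose G x := `|g x| `^ (4 / 3).
have mz1 := @measurable_fst _ _ (R3 R) (R3 R).
have mz2 := @measurable_snd _ _ (R3 R) (R3 R).
have tensor (u v : R3 R -> R) : (forall x, 0 <= u x) -> (forall x, 0 <= v x) ->
    (@leb3 R).-integrable setT (EFin \o u) ->
    (@leb3 R).-integrable setT (EFin \o v) ->
    (@leb3 R \x @leb3 R)%E.-integrable setT (fun z => (u z.1 * v z.2)%:E).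
  move=> u0 v0 iu iv.
  apply: (@integrable_fst_mul _ _ _ _ _ (@leb3 R) (@leb3 R) (fun z => v z.2)
    (fine (\int[@leb3 R]_x (v x)%:E)%E)) => //.
    have mv : measurable_fun setT v.
      by apply/measurable_EFinP; exact: measurable_int iv.
    exact: measurableT_comp mv mz2.
  by move=> x /=; rewrite fineK//; exact: (integrable_fin_num _ iv).
have mk2 : measurable_fun setT (fun z : R3 R * R3 R => near_newton_sq z.1 z.2).
  exact: measurable_near_newton_sq.
have i1 := tensor (fun x => `|f x|) (fun x => `|g x|)
  (fun x => normr_ge0 _) (fun x => normr_ge0 _) f1 g1.
have i2 := tensor F G (fun x => powR_ge0 _ _) (fun x => powR_ge0 _ _) f2 g2.
have i3 : (@leb3 R \x @leb3 R)%E.-integrable setT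
    (fun z => (F z.1 * near_newton_sq z.1 z.2)%:E).
  apply: (@integrable_fst_mul _ _ _ _ _ _ _
    (fun z => near_newton_sq z.1 z.2) 64) => //.
  - by move=> z; exact: near_newton_sq_ge0.
  - exact: integral_near_newton_sq.
  - by move=> x; exact: powR_ge0.
have i4 : (@leb3 R \x @leb3 R)%E.-integrable setT
    (fun z => (G z.2 * near_newton_sq z.1 z.2)%:E).
  apply: (@integrable_snd_mul _ _ _ _ _ _ _
    (fun z => near_newton_sq z.1 z.2) 64) => //.
  - by move=> z; exact: near_newton_sq_ge0.
  - move=> y /=; under eq_integral do rewrite near_newton_sqC.
    exact: integral_near_newton_sq.
  - by move=> x; exact: powR_ge0.
have i := integrableD measurableT
  (integrableD measurableT (integrableD measurableT i1 i2) i3) i4.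
apply: le_integrable i => //.
  apply/measurable_EFinP; apply: measurable_funM; last exact: measurable_newton.
  by apply: measurable_funM; exact: measurableT_comp.
move=> z _; rewrite [leRHS](_ : _ = (`| `|f z.1| * `|g z.2| + F z.1 * G z.2
    + F z.1 * near_newton_sq z.1 z.2 + G z.2 * near_newton_sq z.1 z.2|)%:E)//.
rewrite /= lee_fin !normrM [X in _ * X <= _]ger0_norm ?newton_ge0//.
by apply: (le_trans _ (ler_norm _)); exact: newton_young.
Qed.

End Pairs.

(** * Densities and perturbations *)

Lemma ae_le_integrable d (T : measurableType d) (R : realType)
    (mu : {measure set T -> \bar R}) (f g : T -> R) :
  measurable_fun setT f -> {ae mu, forall x, `|f x| <= g x} ->
  mu.-integrable setT (EFin \o g) -> mu.-integrable setT (EFin \o f).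
Proof.
move=> mf fg /integrableP[mg goo]; apply/integrableP; split.
  exact/measurable_EFinP.
apply: le_lt_trans goo; apply: ae_ge0_le_integral => //.
- by apply: measurableT_comp => //; exact/measurable_EFinP.
- exact: measurableT_comp.
by apply: filterS fg => x /= fg _; rewrite lee_fin (le_trans fg)// ler_norm.
Qed.

Section Densities.
Context {R : realType}.
Implicit Types (rho tau : R3 R -> R) (m r : R).

Definition origin : R3 R := ((0, 0), 0).

Lemma integrable_cube M r : 0 <= r ->
  (@leb3 R).-integrable setT (EFin \o (fun x => M * \1_(cube origin r) x)).
Proof.
move=> r0; apply: (@integrableZl _ _ _ _ _ measurableT M
  (EFin \o \1_(cube origin r))).
have mc := measurable_cube origin r.
apply/integrableP; split; first exact/measurable_EFinP/measurable_indic.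
under eq_integral do rewrite gee0_abs ?lee_fin//.
by rewrite integral_indic// setIT
  (_ : (_ < _)%E = (leb3 (cube origin r) < +oo)%E)// leb3_cube// ltry.
Qed.

Lemma massR_ge0 m rho : massR m rho -> {ae @leb3 R, forall x, 0 <= rho x}.
Proof. by case. Qed.

Lemma massR_L1L43 m rho : massR m rho -> L1L43 rho.
Proof.
move=> [rhoL rho0 rhom].
have mrho : measurable_fun setT rho.
  by move: rhoL; rewrite inE => /andP[/[!inE]].
split => //; last by apply: Lfun_integrable rhoL; lra.
apply/integrableP; split.
  by apply/measurable_EFinP; exact: measurableT_comp.
rewrite (ae_eq_integral (EFin \o rho))//.
- by rewrite rhom ltry.
- apply: measurableT_comp => //; apply/measurable_EFinP.
  exact: measurableT_comp.
- exact/measurable_EFinP.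
by apply: filterS rho0 => x /= rho0 _; rewrite !ger0_norm.
Qed.

(** Boundedness and compact support enter the estimates only in this form; the
    ball of radius r is contained in the cube of half-side r. *)
Lemma PR_dominated rho r tau : 0 < r -> PR rho r tau -> 
  measurable_fun setT tau /\ exists2 M, 0 < M &
    {ae @leb3 R, forall x, `|tau x| <= M * \1_(cube origin r) x}.
Proof.
move=> r0 [tauL tau0 _].
have [mtau tauoo] : measurable_fun setT tau /\ finite_norm (@leb3 R) +oo%E tau.
  by move: tauL; rewrite inE => /andP[/[!inE]].
split => //.
have [M M0 tauM] : exists2 M : R, 0 < M & {ae @leb3 R, forall x, `|tau x| <= M}.
  move: tauoo; rewrite /finite_norm unlock; case: ifPn => [_ h|].
    have := ess_sup_ge (@leb3 R) (abse \o (EFin \o tau)).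
    move: h; case: (ess_sup _ _) => [M| |]//= _ h.
      exists (Num.max M 1); first by rewrite lt_max ltr01 orbT.
      by apply: filterS h => x; rewrite lee_fin le_max => ->.
    by exists 1 => //; apply: filterS h => x.
  rewrite -leNgt measure_le0 => /eqP h _; exists 1 => //.
  by exists setT; split.
exists M => //; apply: filterS2 tauM tau0 => x tauM tau0.
rewrite indicE; case: (boolP (x \in _)) => [_|]; first by rewrite mulr1.
rewrite notin_setE => xr; rewrite mulr0 tau0 ?normr0//; right.
rewrite ltNge; apply/negP => xle; apply: xr; apply: enorm_sub3_cube.
rewrite enorm_sub3C (_ : sub3 x origin = x)//.
by case: x xle {tauM tau0} => -[a b] c _; rewrite /sub3/= !subr0.
Qed.

Lemma PR_L1L43 rho r tau : 0 < r -> PR rho r tau -> L1L43 tau.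
Proof.
move=> r0 /(PR_dominated r0)[mtau [M M0 tauM]]; split => //.
  apply: (@ae_le_integrable _ _ _ _ _ (fun x => M * \1_(cube origin r) x)).
  - exact: measurableT_comp.
  - by apply: filterS tauM => x; rewrite normr_id.
  - exact/integrable_cube/ltW.
apply: (@ae_le_integrable _ _ _ _ _
    (fun x => M `^ (4 / 3) * \1_(cube origin r) x)).
- by apply: (measurableT_comp (measurable_powR _)); exact: measurableT_comp.
- apply: filterS tauM => x /= h; rewrite ger0_norm ?powR_ge0//.
  move: h; rewrite indicE; case: (x \in _) => /= h; last first.
    by move: h; rewrite !mulr0 normr_le0 => /eqP ->; rewrite normr0 powR0.
  move: h; rewrite !mulr1 => h; rewrite ge0_ler_powR// ?nnegrE//.
  exact: ltW.
- exact/integrable_cube/ltW.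
Qed.

End Densities.

(** * Powers with exponent greater than 1 *)

Section PowerFunction.
Context {R : realType}.
Implicit Types (a b s h gamma : R).

Lemma is_derive_powR gamma a : 0 < a ->
  is_derive a 1 (fun u => u `^ gamma) (gamma * a `^ (gamma - 1)).
Proof.
move=> a0; have ai : a \in `]0, +oo[%R by rewrite in_itv/= a0.
by apply: DeriveDef; [exact: derivable_powR |
  rewrite -derive1E; exact: powR_derive1].
Qed.

Lemma powR_lipschitz gamma L a b : 1 < gamma -> 0 <= a <= L -> 0 <= b <= L ->
  `|b `^ gamma - a `^ gamma| <= gamma * L `^ (gamma - 1) * `|b - a|.
Proof.
move=> g1.
wlog ab : a b / a <= b => [hw aL bL|/andP[a0 aL] /andP[b0 bL]].
  have [ab|/ltW ba] := leP a b; first exact: hw.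
  by rewrite distrC (distrC b); exact: hw.
have g0 : 0 < gamma by lra.
have Lb c : 0 <= c <= L -> c `^ (gamma - 1) <= L `^ (gamma - 1).
  move=> /andP[c0 cL]; apply: ge0_ler_powR; rewrite ?nnegrE//; lra.
rewrite !ger0_norm ?subr_ge0//; last first.
  by apply: ge0_ler_powR; rewrite ?nnegrE// ltW.
(* The power function need not be differentiable from the left at 0: the
   mean value theorem is used only when a is positive. *)
have [a00|a0'] := eqVneq a 0.
  rewrite a00 powR0 ?gt_eqF// !subr0.
  have -> : b `^ gamma = 1 * b `^ (gamma - 1) * b.
    by rewrite mul1r; move: b0; rewrite le_eqVlt => /predU1P[<-|b0];
      [rewrite mulr0 powR0 ?gt_eqF |
       rewrite -{3}(powRr1 (ltW b0)) -powRD ?subrK// gt_eqF ?implybT].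
  rewrite ler_wpM2r//; apply: ler_pM; rewrite ?powR_ge0 ?(ltW g1)//.
  by apply: Lb; rewrite b0.
have {a0'}ap : 0 < a by rewrite lt_def a0'.
have [||c cab ->] := @MVT_segment R (fun u => u `^ gamma)
  (fun u => gamma * u `^ (gamma - 1)) a b ab.
- move=> x; rewrite in_itv/= => /andP[ax _]; apply: is_derive_powR.
  exact: lt_trans ax.
- apply: derivable_within_continuous => x; rewrite in_itv/= => /andP[ax _].
  by have [] := is_derive_powR gamma (lt_le_trans ap ax).
move: cab; rewrite in_itv/= => /andP[ac cb].
rewrite ler_wpM2r ?subr_ge0//; apply: ler_pM; rewrite ?powR_ge0 ?(ltW g0)//.
by apply: Lb; lra.
Qed.

(** At s = 0 only increments h >= 0 make sense, and the quotient is
    t^(gamma - 1) h^gamma, which tends to 0. *)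
Lemma powR_right_derivative gamma s h : 1 < gamma -> 0 <= s ->
    (s = 0 -> 0 <= h) ->
  t^-1 * ((s + t * h) `^ gamma - s `^ gamma) @[t --> 0^'+]
    --> gamma * s `^ (gamma - 1) * h.
Proof.
move=> g1; rewrite le_eqVlt => /predU1P[<- /(_ erefl) h0|s0 _].
  rewrite !powR0 ?gt_eqF ?subr_gt0 ?(lt_trans ltr01)// mulr0 mul0r.
  apply: (@cvg_trans _ (t `^ (gamma - 1) * h `^ gamma @[t --> 0^'+])).
    apply: near_eq_cvg; near=> t.
    have t0 : 0 < t by near: t; exact: nbhs_right_gt.
    rewrite add0r subr0 powRM ?(ltW t0)// [RHS]mulrA; congr (_ * _).
    by rewrite -powR_inv1 ?ltW// -powRD 1?addrC // (gt_eqF t0) implybT.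
  have : t `^ (gamma - 1) @[t --> 0^'+] --> (0 : R).
    by apply: powR_cvg0; rewrite subr_gt0.
  by move=> /cvgMr_tmp-/(_ (h `^ gamma)); rewrite mul0r; exact.
have [-> |h0] := eqVneq h 0.
  rewrite mulr0; apply: cvg_near_cst; near=> t.
  by rewrite mulr0 addr0 subrr mulr0.
have D : is_derive (0 : R) 1 ((fun u => u `^ gamma) \o (fun t => s + t * h))
    (gamma * s `^ (gamma - 1) * h).
  apply: is_derive1_comp.
    by rewrite mul0r addr0; exact: is_derive_powR.
  by apply: is_derive_eq; rewrite scaler0 !add0r mul1r /GRing.scale/= mulr1.
have [/cvg_ex[l lE] D'] := D.
have <- : l = gamma * s `^ (gamma - 1) * h.
  by rewrite -D' /derive; apply/esym/cvg_lim.
apply: cvg_dnbhs_at_right; apply: cvg_trans lE.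
apply: near_eq_cvg; near=> t => /=.
by rewrite /GRing.scale/= mulr1 addr0 mul0r addr0.
Unshelve. all: by end_near. Qed.

End PowerFunction.

(** * Derivative of the internal energy *)

(** Dominated convergence along a real parameter decreasing to 0: the
    sequential theorem is applied to every sequence tending to 0 from the
    right, with its first terms dropped so that the domination holds. *)
Lemma dominated_cvg_at_right d (T : measurableType d) (R : realType)
    (mu : {measure set T -> \bar R}) (F : R -> T -> R) (f g : T -> R) (t0 : R) :
  0 < t0 ->
  (forall t, 0 < t < t0 -> measurable_fun setT (F t)) ->
  measurable_fun setT f ->
  {ae mu, forall x, F t x @[t --> 0^'+] --> f x} ->
  mu.-integrable setT (EFin \o g) ->
  {ae mu, forall x t, 0 < t < t0 -> `|F t x| <= g x} ->
  mu.-integrable setT (EFin \o f) /\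
  fine (\int[mu]_x (F t x)%:E)%E @[t --> 0^'+] --> fine (\int[mu]_x (f x)%:E)%E.
Proof.
move=> t00 mF mf Ff ig Fg.
have along (u : R^nat) : (forall n, 0 < u n < t0) -> u n @[n --> \oo] --> 0 ->
    mu.-integrable setT (EFin \o f) /\
    fine (\int[mu]_x (F (u n) x)%:E)%E @[n --> \oo]
      --> fine (\int[mu]_x (f x)%:E)%E.
  move=> u0 ucvg.
  have [|||||if_ _ cvgI] := @dominated_convergence _ _ _ mu setT measurableT
    (fun n => EFin \o F (u n)) (EFin \o f) (EFin \o g).
  - by move=> n; apply/measurable_EFinP; exact: mF.
  - exact/measurable_EFinP.
  - apply: filterS Ff => x /cvg_at_rightP Ff _; apply/cvg_EFin.
      exact: nearW.
    by apply: Ff; split => // n; have /andP[] := u0 n.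
  - exact: ig.
  - by apply: filterS Fg => x Fg n _; rewrite lee_fin; exact: Fg.
  split => //; apply: fine_cvg; rewrite fineK//.
  exact: (integrable_fin_num _ if_).
split.
  have [|| //] := along (fun n => t0 / n.+2%:R).
    move=> n; rewrite divr_gt0//= ltr_pdivrMr// ltr_pMr// ltr1n//.
  rewrite -[X in _ --> X](mulr0 t0); apply: cvgMl_tmp.
  by have := @cvg_harmonic R; rewrite -cvg_shiftS; exact.
apply/cvg_at_rightP => u [u0 ucvg].
have /cvgrPdist_lt/(_ _ t00)[N _ uN] := ucvg.
rewrite -(cvg_shiftn N).
have [||_] := along (fun n => u (n + N)%N).
- move=> n; rewrite u0/=; have := uN (n + N)%N (leq_addl _ _).
  by rewrite /= sub0r normrN ger0_norm// ltW.
- by rewrite (cvg_shiftn N).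
- exact.
Qed.

Section Internal.
Context {R : realType}.
Implicit Types (rho tau : R3 R -> R) (r gamma t : R).

Definition power_quotient gamma rho tau t (x : R3 R) : R :=
  t^-1 * ((rho x + t * tau x) `^ gamma - rho x `^ gamma).

Lemma measurable_power_quotient gamma rho tau t :
  measurable_fun setT rho -> measurable_fun setT tau ->
  measurable_fun setT (power_quotient gamma rho tau t).
Proof.
move=> mrho mtau; apply: measurable_funM => //.
apply: measurable_funB; apply: (measurableT_comp (measurable_powR _)) => //.
by apply: measurable_funD => //; exact: measurable_funM.
Qed.

(** The bounds t < 1 and t M < 1/r on t keep rho + t tau between 0 and r + M
    on the support of tau: where rho < 1/r the perturbation is nonnegative, and
    elsewhere it is too small to cancel rho. *)
Lemma power_quotient_dominated gamma rho r tau : 1 < gamma -> 0 < r ->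
  {ae @leb3 R, forall x, 0 <= rho x} -> PR rho r tau ->
  exists g, exists2 t0, 0 < t0 & (@leb3 R).-integrable setT (EFin \o g) /\
   {ae @leb3 R, forall x t, 0 < t < t0 ->
     `|power_quotient gamma rho tau t x| <= g x}.
Proof.
move=> g1 r0 rho0 tauP.
have [mtau [M M0 tauM]] := PR_dominated r0 tauP.
have [_ tauz tauge] := tauP.
pose L := r + M.
exists (fun x => gamma * L `^ (gamma - 1) * M * \1_(cube origin r) x).
exists (Num.min 1 (r^-1 / M)).
  by rewrite lt_min ltr01/= divr_gt0// invr_gt0.
split; first exact/integrable_cube/ltW.
have rho0_tauM : {ae @leb3 R, forall x,
    0 <= rho x /\ `|tau x| <= M * \1_(cube origin r) x}.
  by apply: filterS2 rho0 tauM.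
apply: filterS3 rho0_tauM tauz tauge => x [{}rho0 {}tauM] {}tauz {}tauge t.
move=> /andP[t0].
rewrite lt_min ltr_pdivlMr// => /andP[t1 tM].
have C0 : 0 <= gamma * L `^ (gamma - 1).
  by rewrite mulr_ge0 ?powR_ge0// (le_trans ler01)// ltW.
have [taux|/eqP taux] := eqVneq (tau x) 0.
  rewrite /power_quotient taux mulr0 addr0 subrr mulr0 normr0.
  by rewrite mulr_ge0// mulr_ge0// ltW.
have rhor : rho x <= r by rewrite leNgt; apply/negP => h; apply/taux/tauz; left.
have tauM' : `|tau x| <= M.
  by apply: (le_trans tauM); rewrite ler_piMr ?(ltW M0)// indicE;
    case: (_ \in _).
have tb : `|t * tau x| <= t * M by rewrite normrM gtr0_norm// ler_pM2l.
have [tl tu] : - (t * M) <= t * tau x /\ t * tau x <= t * M.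
  by move: tb; rewrite ler_norml => /andP.
have tMM : t * M <= M by rewrite ler_piMl ?(ltW M0) ?(ltW t1).
have new0 : 0 <= rho x + t * tau x.
  have [h|h] := ltP (rho x) r^-1; last by lra.
  by rewrite addr_ge0// mulr_ge0 ?tauge// ltW.
rewrite /power_quotient normrM gtr0_norm ?invr_gt0//.
rewrite mulrC ler_pdivrMr//.
have := @powR_lipschitz _ gamma L (rho x) (rho x + t * tau x) g1.
rewrite [rho x + _]addrC addrK => /(_ _ _)/le_trans; apply.
- by rewrite rho0/= /L; lra.
- by rewrite addrC new0/= /L; lra.
rewrite normrM gtr0_norm// mulrCA [leRHS]mulrC ler_pM2l//.
by rewrite -[leRHS]mulrA; apply: ler_wpM2l.
Qed.

Lemma internal_derivative gamma rho r tau : 1 < gamma -> 0 < r ->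
  measurable_fun setT rho -> {ae @leb3 R, forall x, 0 <= rho x} ->
  PR rho r tau ->
  [/\ exists2 t0, 0 < t0 & forall t, 0 < t < t0 ->
        (@leb3 R).-integrable setT (EFin \o power_quotient gamma rho tau t),
   (@leb3 R).-integrable setT
      (fun x => (gamma * rho x `^ (gamma - 1) * tau x)%:E) &
   fine (\int[@leb3 R]_x (power_quotient gamma rho tau t x)%:E)%E @[t --> 0^'+]
    --> fine (\int[@leb3 R]_x (gamma * rho x `^ (gamma - 1) * tau x)%:E)%E].
Proof.
move=> g1 r0 mrho rho0 tauP.
have [g [t0 t00 [ig Fg]]] := power_quotient_dominated g1 r0 rho0 tauP.
have [mtau _] := PR_dominated r0 tauP.
have [_ _ tauge] := tauP.
have mD : measurable_fun setT (fun x => gamma * rho x `^ (gamma - 1) * tau x).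
  apply: measurable_funM => //; apply: measurable_funM => //.
  exact: (measurableT_comp (measurable_powR _)).
have mF t := measurable_power_quotient gamma t mrho mtau.
have cvgF : {ae @leb3 R, forall x,
    power_quotient gamma rho tau t x @[t --> 0^'+]
    --> gamma * rho x `^ (gamma - 1) * tau x}.
  apply: filterS2 rho0 tauge => x rhox taux; apply: powR_right_derivative => //.
  by move=> rhox0; apply: taux; rewrite rhox0 invr_gt0.
have [iD lD] := dominated_cvg_at_right t00 (fun t _ => mF t) mD cvgF ig Fg.
split => //; exists t0 => // t tt0; apply: ae_le_integrable ig => //.
by apply: filterS Fg => x; exact.
Qed.

End Internal.

(** * Gravitational energy and potential *)

Section Gravity.
Context {R : realType}.
Implicit Types (rho tau f g : R3 R -> R) (x y : R3 R).

Definition interaction f g : \bar R :=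
  (\int[(@leb3 R \x @leb3 R)]_z (f z.1 * g z.2 * newton z.1 z.2)%:E)%E.

Lemma interaction_fin_num f g : L1L43 f -> L1L43 g ->
  interaction f g \is a fin_num.
Proof. by move=> Lf Lg; exact: integrable_fin_num (pair_integrable Lf Lg). Qed.

Lemma interactionC f g : L1L43 f -> L1L43 g ->
  interaction f g = interaction g f.
Proof.
move=> Lf Lg; rewrite /interaction.
rewrite -(integral12_prod_meas1 (pair_integrable Lf Lg)).
rewrite -(integral21_prod_meas1 (pair_integrable Lg Lf)).
apply: eq_integral => x _; apply: eq_integral => y _ /=.
by rewrite newtonC [f x * g y]mulrC.
Qed.

Lemma grav_energy_perturb rho tau t : L1L43 rho -> L1L43 tau ->
  grav_energy (fun x => rho x + t * tau x) =
  (fine (grav_energy rho) + 2 * t * fine (interaction tau rho)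
    + t ^+ 2 * fine (interaction tau tau))%:E.
Proof.
move=> Lr Lt.
have irr := pair_integrable Lr Lr; have itr := pair_integrable Lt Lr.
have irt := pair_integrable Lr Lt; have itt := pair_integrable Lt Lt.
have irt' := integrableZl measurableT t irt.
have itr' := integrableZl measurableT t itr.
have itt' := integrableZl measurableT (t ^+ 2) itt.
rewrite /grav_energy.
transitivity (interaction rho rho + (t%:E * interaction rho tau
   + t%:E * interaction tau rho) + (t ^+ 2)%:E * interaction tau tau)%E.
  have i1 := integrableD measurableT irt' itr'.
  have i2 := integrableD measurableT irr i1.
  rewrite /interaction -(integralZl measurableT irt).
  rewrite -(integralZl measurableT itr).
  rewrite -(integralZl measurableT itt) -(integralD measurableT irt' itr').
  rewrite -(integralD measurableT irr i1) -(integralD measurableT i2 itt').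
  apply: eq_integral => z _; rewrite -!EFinM -!EFinD; congr (_%:E).
  by rewrite -/(newton z.1 z.2); ring.
rewrite (interactionC Lr Lt).
rewrite -(fineK (interaction_fin_num Lr Lr)).
rewrite -(fineK (interaction_fin_num Lt Lr)).
rewrite -(fineK (interaction_fin_num Lt Lt)) -!EFinM -!EFinD; congr (_%:E).
by rewrite -/(interaction rho rho) /=; ring.
Qed.

Lemma measurable_potential_integrand rho x : measurable_fun setT rho ->
  measurable_fun setT (fun y => (rho y / enorm (sub3 x y))%:E).
Proof.
by move=> mrho; apply/measurable_EFinP; apply: measurable_funM => //;
  apply: measurable_newton.
Qed.

(** The equality is at every point x, so that a density can be replaced by its
    positive part without exceptional points. *)
Lemma potential_ae rho rho' x :
  measurable_fun setT rho -> measurable_fun setT rho' ->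
  {ae @leb3 R, forall x, rho x = rho' x} -> potential rho x = potential rho' x.
Proof.
move=> mr mr' e; apply: ae_eq_integral => //;
  do ?exact: measurable_potential_integrand.
by apply: filterS e => y /= -> .
Qed.

Section Potential.
Variable rho : R3 R -> R.
Hypotheses (mrho : measurable_fun setT rho)
  (rho0 : {ae @leb3 R, forall x, 0 <= rho x}).

(* A representative that is nonnegative everywhere: a constant can then be
   pulled out of the integral even if the integral is infinite. *)
Let rhop x := Num.max (rho x) 0.

Let mrhop : measurable_fun setT rhop.
Proof. exact: measurable_maxr. Qed.

Let rhop_ge0 x : 0 <= rhop x. Proof. by rewrite le_max lexx orbT. Qed.

Let potentialE x : potential rho x = potential rhop x.
Proof.
apply: potential_ae => //; apply: filterS rho0 => y r0.
by rewrite /rhop max_l.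
Qed.

Let integrand_ge0 x y : (0 <= (rhop y / enorm (sub3 x y))%:E)%E.
Proof. by rewrite lee_fin divr_ge0// enorm_ge0. Qed.

(** Holds also where the potential is infinite: the integrand has the constant
    sign of c, so a negative c reduces to a positive one by a change of
    sign. *)
Lemma potential_mul (c : R) x :
  (\int[@leb3 R]_y (c * rho y * newton x y)%:E = potential rho x * c%:E)%E.
Proof.
have -> : (\int[@leb3 R]_y (c * rho y * newton x y)%:E =
    \int[@leb3 R]_y (c%:E * (rhop y * newton x y)%:E))%E.
  apply: ae_eq_integral => //.
  - apply/measurable_EFinP.
    apply: measurable_funM; last exact: measurable_newton.
    exact: measurable_funM.
  - apply: emeasurable_funM => //; exact: measurable_potential_integrand.
  - apply: filterS rho0 => y r0 _.
    by rewrite /rhop max_l// -EFinM mulrA.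
rewrite potentialE muleC.
have [c0|/ltW c0] := leP 0 c.
  by rewrite ge0_integralZl//; [exact: measurable_potential_integrand|
    move=> y _; exact: integrand_ge0].
transitivity (\int[@leb3 R]_y (- ((- c)%:E * (rhop y * newton x y)%:E)))%E.
  by apply: eq_integral => y _; rewrite -EFinM -EFinN mulNr opprK.
rewrite integral_ge0N; last first.
  by move=> y _; rewrite mule_ge0 ?lee_fin ?oppr_ge0//; exact: integrand_ge0.
rewrite ge0_integralZl//; last 3 first.
- exact: measurable_potential_integrand.
- by move=> y _; exact: integrand_ge0.
- by rewrite lee_fin oppr_ge0.
by rewrite EFinN mulNe oppeK.
Qed.

(** By [potential_mul], V_rho tau is exactly the inner integral in Fubini's
    theorem, with no exceptional set where V_rho is infinite. *)
Lemma potential_mul_integrable tau : L1L43 rho -> L1L43 tau ->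
  (@leb3 R).-integrable setT (fun x => potential rho x * (tau x)%:E)%E /\
  (\int[@leb3 R]_x (potential rho x * (tau x)%:E) = interaction tau rho)%E.
Proof.
move=> Lr Lt; have itr := pair_integrable Lt Lr.
have E : fubini_F (@leb3 R) (fun z => (tau z.1 * rho z.2 * newton z.1 z.2)%:E) =
    (fun x => potential rho x * (tau x)%:E)%E.
  by apply/funext => x; rewrite -potential_mul.
split; first by rewrite -E; exact: integrable_fubini_F.
by rewrite -[RHS]integral12_prod_meas1// E.
Qed.

End Potential.
End Gravity.

(** * Dilations of R^3 *)

Section ProductDilation.
Context {R : realType}.

Definition dilates d (T : measurableType d) (m : {measure set T -> \bar R})
    (phi : T -> T) (c : R) :=
  forall X, measurable X -> m X = (c%:E * m (phi @^-1` X))%E.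

Definition prod_map (T1 T2 : Type) (f1 : T1 -> T1) (f2 : T2 -> T2)
    (z : T1 * T2) :=
  (f1 z.1, f2 z.2).

Lemma measurable_prod_map d1 d2
    (T1 : measurableType d1) (T2 : measurableType d2)
    (f1 : T1 -> T1) (f2 : T2 -> T2) :
  measurable_fun setT f1 -> measurable_fun setT f2 ->
  measurable_fun setT (prod_map f1 f2).
Proof.
by move=> m1 m2; apply: measurable_fun_pair; exact: measurableT_comp.
Qed.

(** Both sides are measures in X that agree on rectangles. *)
Lemma dilates_prod d1 d2 (T1 : measurableType d1) (T2 : measurableType d2)
    (m1 : {sigma_finite_measure set T1 -> \bar R})
    (m2 : {sigma_finite_measure set T2 -> \bar R})
    (f1 : T1 -> T1) (f2 : T2 -> T2) (c1 c2 : R) :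
  measurable_fun setT f1 -> measurable_fun setT f2 -> 0 <= c1 -> 0 <= c2 ->
  dilates m1 f1 c1 -> dilates m2 f2 c2 ->
  forall X, measurable X -> 
  (m1 \x m2)%E X = ((c1 * c2)%:E * (m1 \x m2)%E (prod_map f1 f2 @^-1` X))%E.
Proof.
move=> mf1 mf2 c10 c20 D1 D2 X mX.
have mf := measurable_prod_map mf1 mf2.
pose f : {mfun _ >-> _} := HB.pack (prod_map f1 f2)
  (isMeasurableFun.Build _ _ _ _ _ mf).
pose c : {nonneg R} := NngNum (mulr_ge0 c10 c20).
apply: (@product_measure_unique _ _ _ _ _ m1 m2
  (mscale c (pushforward (m1 \x m2)%E f))) => // A B mA mB.
transitivity ((c1 * c2)%:E * (m1 \x m2) ((f1 @^-1` A) `*` (f2 @^-1` B)))%E => //.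
rewrite product_measure1E//; last 2 first.
- by rewrite -[X in measurable X]setTI; exact: mf1.
- by rewrite -[X in measurable X]setTI; exact: mf2.
rewrite [X in _ = (X * _)%E](D1 _ mA) [X in _ = (_ * X)%E](D2 _ mB).
by rewrite EFinM muleACA.
Qed.

(** Both sides are measures in X that agree on the intervals ]u, v]. *)
Lemma lebesgue_dilates (b : R) : 0 < b ->
  dilates (@lebesgue_measure R)
    ( *%R b : measurableTypeR R -> measurableTypeR R) b.
Proof.
move=> b0 X mX.
have mf : measurable_fun setT ( *%R b : measurableTypeR R -> measurableTypeR R).
  exact: measurable_funM.
pose f : {mfun measurableTypeR R >-> measurableTypeR R} := HB.pack
  ( *%R b : measurableTypeR R -> measurableTypeR R)
  (isMeasurableFun.Build _ _ _ _ _ mf).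
pose c : {nonneg R} := NngNum (ltW b0).
apply: (@lebesgue_measure_unique _
  (mscale c (pushforward (@lebesgue_measure R) f))) => // _ [[u v] _ <-]/=.
rewrite /mscale/= /pushforward.
have -> : *%R b @^-1` `]u, v] = `]u / b, v / b]%classic.
  by apply/seteqP; split => x /=;
    rewrite !in_itv/= ltr_pdivrMr// ler_pdivlMr// mulrC.
rewrite !lebesgue_measure_itv/= !lte_fin ltr_pM2r ?invr_gt0//.
case: ifP => _; last by rewrite mule0.
by rewrite -!EFinD -EFinM; congr (_%:E); field; rewrite gt_eqF.
Qed.

End ProductDilation.

Section Scaling.
Context {R : realType}.
Variable b : R.
Hypothesis b0 : 0 < b.

Lemma measurable_scale3 (a : R) :
  measurable_fun setT (scale3 a : R3 R -> R3 R).
Proof.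
have m : measurable_fun setT ( *%R a : measurableTypeR R -> measurableTypeR R).
  exact: measurable_funM.
exact: measurable_prod_map (measurable_prod_map m m) m.
Qed.

Lemma leb3_dilates : dilates (@leb3 R) (scale3 b) (b ^+ 3).
Proof.
have m : measurable_fun setT ( *%R b : measurableTypeR R -> measurableTypeR R).
  exact: measurable_funM.
have D := lebesgue_dilates b0.
have D2 : dilates (@leb2 R) (prod_map ( *%R b) ( *%R b)) (b * b).
  by move=> X mX; apply: dilates_prod => //; exact: ltW.
move=> X mX.
rewrite (_ : b ^+ 3 = b * b * b); last by ring.
apply: (dilates_prod (measurable_prod_map m m) m _ _ D2 D) => //.
  by rewrite mulr_ge0// ltW.
exact: ltW.
Qed.

Lemma ae_scale3 (P : R3 R -> Prop) :
  {ae @leb3 R, forall x, P x} -> {ae @leb3 R, forall x, P (scale3 b x)}.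
Proof.
move=> [N [mN N0 PN]]; exists (scale3 b @^-1` N); split.
- by rewrite -[X in measurable X]setTI; exact: measurable_scale3.
- have : (leb3 N = (b ^+ 3)%:E * leb3 (scale3 b @^-1` N))%E := leb3_dilates mN.
  rewrite N0 => /esym/eqP.
  by rewrite mule_eq0 eqe expf_eq0/= (gt_eqF b0)/= => /eqP.
- by move=> x /=; exact: PN.
Qed.

Lemma ge0_integral_scale3 (f : R3 R -> \bar R) : measurable_fun setT f ->
  (forall x, 0 <= f x)%E ->
  (\int[@leb3 R]_x f (scale3 b x) = ((b ^+ 3)^-1)%:E * \int[@leb3 R]_x f x)%E.
Proof.
move=> mf f0.
have ms := measurable_scale3 b.
have b30 : 0 < b ^+ 3 by rewrite exprn_gt0.
have bV0 : 0 <= (b ^+ 3)^-1 by rewrite invr_ge0 ltW.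
transitivity (\int[pushforward (@leb3 R) (scale3 b : R3 R -> R3 R)]_x f x)%E.
  by rewrite (ge0_integral_pushforward ms).
rewrite -[RHS](ge0_integral_mscale (@leb3 R) measurableT (NngNum bV0))//.
apply: eq_measure_integral => //= A mA _.
rewrite /pushforward /mscale/= [X in (_ * X)%E](leb3_dilates mA).
by rewrite muleA -EFinM mulVf ?gt_eqF// mul1e.
Qed.

(** Reduction to the positive part; null sets are preserved by dilation. *)
Lemma ae_ge0_integral_scale3 (f : R3 R -> R) : measurable_fun setT f ->
  {ae @leb3 R, forall x, 0 <= f x} ->
  (\int[@leb3 R]_x (f (scale3 b x))%:E
   = ((b ^+ 3)^-1)%:E * \int[@leb3 R]_x (f x)%:E)%E.
Proof.
move=> mf f0; pose g x := Num.max (f x) 0.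
have mg : measurable_fun setT g by exact: measurable_maxr.
have gf : {ae @leb3 R, forall x, f x = g x}.
  by apply: filterS f0 => x f0x; rewrite /g max_l.
have -> : (\int[@leb3 R]_x (f x)%:E = \int[@leb3 R]_x (g x)%:E)%E.
  apply: ae_eq_integral => //; [exact/measurable_EFinP..|].
  by apply: filterS gf => x /= -> .
rewrite -(@ge0_integral_scale3 (EFin \o g)); first last.
- by move=> x; rewrite lee_fin le_max lexx orbT.
- exact/measurable_EFinP.
have ms := measurable_scale3 b.
apply: ae_eq_integral => //.
- by apply/measurable_EFinP; exact: measurableT_comp mf ms.
- by apply/measurable_EFinP; exact: measurableT_comp mg ms.
by apply: filterS (ae_scale3 gf) => x /= -> .
Qed.

Lemma Lfun_scale3 (p : R) (f : R3 R -> R) : 1 <= p ->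
  f \in Lfun (@leb3 R) p%:E -> f \o scale3 b \in Lfun (@leb3 R) p%:E.
Proof.
move=> p1 Lf; have mf : measurable_fun setT f.
  by move: Lf; rewrite inE => /andP[/[!inE]].
rewrite inE; apply/andP; split; rewrite inE/=.
  exact: measurableT_comp mf (measurable_scale3 b).
have fp := Lfun_integrable p1 Lf.
rewrite /finite_norm unlock; apply: poweR_lty.
rewrite (@ge0_integral_scale3 (fun x => (`|f x| `^ p)%:E)).
- rewrite lte_mul_pinfty ?lee_fin ?invr_ge0 ?exprn_ge0 ?(ltW b0)//.
  exact: integrable_lty fp.
- exact: measurable_int fp.
- by move=> x; rewrite lee_fin powR_ge0.
Qed.

Lemma enorm_scale3 (x : R3 R) : enorm (scale3 b x) = b * enorm x.
Proof.
rewrite /enorm/= !exprMn -!mulrDr sqrtrM ?sqr_ge0// sqrtr_sqr gtr0_norm//.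
Qed.

(** The kernel is homogeneous of degree -1, whence a factor b, and the change
    of variables contributes b^-3. *)
Lemma potential_scale3 (a : R) (rho : R3 R -> R) x : measurable_fun setT rho ->
    {ae @leb3 R, forall x, 0 <= rho x} -> 0 <= a ->
  potential (fun y => a * rho (scale3 b y)) (scale3 b^-1 x) =
  ((a * b / b ^+ 3)%:E * potential rho x)%E.
Proof.
move=> mrho rho0 a0.
have newton_scale y : newton (scale3 b^-1 x) y = b * newton x (scale3 b y).
  have -> : newton x (scale3 b y) = (b * enorm (sub3 (scale3 b^-1 x) y))^-1.
    rewrite -enorm_scale3 /newton /sub3 /scale3/= !mulrBr !mulrA.
    by rewrite divff ?gt_eqF// !mul1r.
  by rewrite invfM mulrA divff ?gt_eqF// mul1r.
transitivity (\int[@leb3 R]_y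
    ((fun z => a * b * rho z * newton x z) (scale3 b y))%:E)%E.
  apply: eq_integral => y _; congr (_%:E).
  by rewrite -/(newton _ _) newton_scale; ring.
rewrite (@ae_ge0_integral_scale3 (fun z => a * b * rho z * newton x z)).
- by rewrite potential_mul// muleCA -EFinM muleC mulrC.
- apply: measurable_funM; last exact: measurable_newton.
  exact: measurable_funM.
- by apply: filterS rho0 => y r0; rewrite !mulr_ge0 ?newton_ge0 ?(ltW b0).
Qed.

End Scaling.

(** * Differentiability of the energy *)

Section Differentiability.
Context {R : realType}.
Variables (K gamma : R) (rho : R3 R -> R).
Hypotheses (K0 : 0 < K) (g1 : 1 < gamma) (Lrho : L1L43 rho).
Hypothesis rho0 : {ae @leb3 R, forall x, 0 <= rho x}.
Hypothesis Urho : (internal_energy K gamma rho < +oo)%E.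

Let c0 : 0 < K / (gamma - 1).
Proof. by rewrite divr_gt0// subr_gt0. Qed.

Lemma internal_energy_integrable : (@leb3 R).-integrable setT
  (fun x => (K / (gamma - 1) * rho x `^ gamma)%:E).
Proof.
have [mrho _ _] := Lrho.
apply/integrableP; split.
  by apply/measurable_EFinP; apply: measurable_funM => //;
    exact: measurableT_comp (measurable_powR _) mrho.
rewrite (_ : (\int[_]_x _)%E = internal_energy K gamma rho)//.
apply: eq_integral => x _; rewrite gee0_abs// lee_fin.
by rewrite mulr_ge0 ?powR_ge0 ?(ltW c0).
Qed.

Lemma internal_energy_perturb tau t : 0 < t ->
  (@leb3 R).-integrable setT (EFin \o power_quotient gamma rho tau t) ->
  internal_energy K gamma (fun x => rho x + t * tau x) =
  (fine (internal_energy K gamma rho) + K / (gamma - 1) * t *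
    fine (\int[@leb3 R]_x (power_quotient gamma rho tau t x)%:E)%E)%:E.
Proof.
move=> t0 iQ; have iU := internal_energy_integrable.
rewrite EFinD EFinM !fineK; last 2 first.
- exact: integrable_fin_num iQ.
- exact: integrable_fin_num iU.
rewrite -(integralZl measurableT iQ) /internal_energy.
rewrite -(integralD measurableT iU (integrableZl measurableT _ iQ)).
apply: eq_integral => x _; rewrite -EFinM -EFinD; congr (_%:E).
move: (K / _) => c; rewrite /power_quotient mulrA mulfK ?gt_eqF//; ring.
Qed.

(** The potential may be infinite at some points, but the other term of the
    derivative is finite, so the product distributes over the difference
    everywhere. *)
Lemma dE0_mul tau : L1L43 tau ->
  (@leb3 R).-integrable setT
    (fun x => (gamma * rho x `^ (gamma - 1) * tau x)%:E) ->
  (@leb3 R).-integrable setT (fun x => dE0 K gamma rho x * (tau x)%:E)%E /\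
  (\int[@leb3 R]_x (dE0 K gamma rho x * (tau x)%:E))%E =
  (K / (gamma - 1) *
     fine (\int[@leb3 R]_x (gamma * rho x `^ (gamma - 1) * tau x)%:E)%E
   - fine (interaction tau rho))%:E.
Proof.
move=> Ltau iD; have [mrho _ _] := Lrho.
have [iV VE] := potential_mul_integrable mrho rho0 Lrho Ltau.
have iD' := integrableZl measurableT (K / (gamma - 1)) iD.
have E : (fun x => dE0 K gamma rho x * (tau x)%:E)%E = (fun x =>
    (K / (gamma - 1))%:E * (gamma * rho x `^ (gamma - 1) * tau x)%:E
    - potential rho x * (tau x)%:E)%E.
  apply/funext => x; rewrite /dE0 muleBl//.
  by congr (_ - _)%E; rewrite -!EFinM; congr (_%:E); ring.
rewrite E; split; first exact: integrableB iD' iV.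
have ifin := interaction_fin_num Ltau Lrho.
have Dfin := integrable_fin_num measurableT iD.
rewrite (integralB measurableT iD' iV) (integralZl measurableT iD) VE.
by rewrite [in RHS]EFinB [in RHS]EFinM !fineK.
Qed.

Lemma E0_differentiable : is_Pinfty_derivative K gamma rho (dE0 K gamma rho).
Proof.
move=> tau [r r0 tauP]; have [mrho _ _] := Lrho.
have Ltau := PR_L1L43 r0 tauP.
have [[t0 t00 iQ] iD cvgQ] := internal_derivative g1 r0 mrho rho0 tauP.
have [idE ->] := dE0_mul Ltau iD; split => //.
pose c := K / (gamma - 1).
pose Q t := fine (\int[@leb3 R]_x (power_quotient gamma rho tau t x)%:E)%E.
pose I1 := fine (interaction tau rho); pose I2 := fine (interaction tau tau).
have Ufin : internal_energy K gamma rho \is a fin_num.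
  exact: integrable_fin_num internal_energy_integrable.
have Gfin : grav_energy rho \is a fin_num by exact: interaction_fin_num.
(* All energies are finite for small t, so the quotient is computed in R. *)
apply: (@cvg_trans _ ((c * Q t - I1 - 2^-1 * I2 * t)%:E @[t --> 0^'+])).
  apply: near_eq_cvg; near=> t.
  have tt0 : 0 < t < t0 by apply/andP; split; near: t;
    [exact: nbhs_right_gt | exact: nbhs_right_lt].
  have t_gt0 : 0 < t by case/andP: tt0.
  rewrite /E0 internal_energy_perturb//; last exact: iQ.
  rewrite grav_energy_perturb// -(fineK Ufin) -(fineK Gfin).
rewrite -!EFinM; congr (_%:E).
  rewrite -/(Q t) -/I1 -/I2 -/c /=; field; rewrite gt_eqF//.
apply: cvg_EFin; first exact: nearW.
rewrite [X in _ --> X](_ : _ = c * fine (\int[@leb3 R]_x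
  (gamma * rho x `^ (gamma - 1) * tau x)%:E)%E - I1 - 2^-1 * I2 * 0);
    last first.
  by rewrite mulr0 subr0.
apply: cvgB; first apply: cvgB.
- exact: cvgMl_tmp cvgQ.
- exact: cvg_cst.
- by apply: cvgMl_tmp; apply: cvg_at_right_filter; exact: cvg_id.
Unshelve. all: by end_near. Qed.

End Differentiability.

(** * The scaling exponents *)

Section ScalingExponents.
Context {R : realType}.
Variables (gamma m : R).
Hypotheses (g43 : 4 / 3 < gamma) (m0 : 0 < m).

Let A := m `^ (- (2 / (3 * gamma - 4))).
Let B := m `^ ((gamma - 2) / (3 * gamma - 4)).

Let d0 : 3 * gamma - 4 != 0.
Proof. by rewrite gt_eqF//; move: g43; lra. Qed.

Let mD (x y : R) : m `^ (x + y) = m `^ x * m `^ y.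
Proof. by rewrite powRD// (gt_eqF m0) implybT. Qed.

(** -2 - 3 (gamma - 2) + (3 gamma - 4) = 0. *)
Lemma mass_exponent : A * ((B ^+ 3)^-1 * m) = 1.
Proof.
rewrite /A /B -powR_mulrn ?powR_ge0// -powRrM -powRN -{3}(powRr1 (ltW m0)) -!mD.
by rewrite [X in m `^ X](_ : _ = 0) ?powRr0//; field.
Qed.

Lemma derivative_exponent : A `^ (- (gamma - 1)) =
  m `^ ((2 * gamma - 2) / (3 * gamma - 4)).
Proof. by rewrite /A -powRrM; congr (_ `^ _); field. Qed.

(** A^(2 - gamma) = B^2: both are m raised to 2 (gamma - 2) / (3 gamma - 4). *)
Lemma potential_exponent : A `^ (- (gamma - 1)) * (A * B / B ^+ 3) = 1.
Proof.
rewrite derivative_exponent /A /B -powR_mulrn ?powR_ge0// -powRrM -powRN -!mD.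
by rewrite [X in m `^ X](_ : _ = 0) ?powRr0//; field.
Qed.

End ScalingExponents.

(** * The derivative at a density of mass m *)

Theorem proposition3p4 (R : realType) (K gamma m : R) (rho_m : R3 R -> R) :
  0 < K -> 4 / 3 < gamma -> 0 < m ->
  massR m rho_m ->
  (internal_energy K gamma rho_m < +oo)%E ->
  let A := m `^ (- (2 / (3 * gamma - 4))) in
  let B := m `^ ((gamma - 2) / (3 * gamma - 4)) in
  let rho := fun x : R3 R => A * rho_m (scale3 B x) in
  [/\ is_Pinfty_derivative K gamma rho_m (dE0 K gamma rho_m),
      massR 1 rho,
      (internal_energy K gamma rho < +oo)%E,
      {ae @leb3 R, forall x,
        dE0 K gamma rho_m x
        = ((A `^ (- (gamma - 1)))%:E * dE0 K gamma rho (scale3 B^-1 x))%E} &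
      {ae @leb3 R, forall x,
        ((A `^ (- (gamma - 1)))%:E * dE0 K gamma rho (scale3 B^-1 x))%E
        = ((m `^ ((2 * gamma - 2) / (3 * gamma - 4)))%:E
            * dE0 K gamma rho (scale3 B^-1 x))%E}].
Proof.
move=> K0 g43 m0 rhoM Urho A B rho.
have g1 : 1 < gamma by lra.
have Lrho := massR_L1L43 rhoM; have rho0 := massR_ge0 rhoM.
have [mrho _ _] := Lrho.
have A0 : 0 < A by rewrite powR_gt0.
have B0 : 0 < B by rewrite powR_gt0.
have c0 : 0 < K / (gamma - 1) by rewrite divr_gt0// subr_gt0.
have mArho : measurable_fun setT (fun x => A * rho_m x).
  exact: measurable_funM.
have Arho0 : {ae @leb3 R, forall x, 0 <= A * rho_m x}.
  by apply: filterS rho0 => x r0; rewrite mulr_ge0// ltW.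
split.
- exact: E0_differentiable.
- split.
  + apply: (@Lfun_scale3 _ B B0 _ (fun x => A * rho_m x)); first lra.
    rewrite (_ : (fun x => _) = A \o* rho_m); last first.
      by apply/funext => x; rewrite /= mulrC.
    by apply: Lfun_scale; [lra|case: rhoM].
  + exact: (ae_scale3 B0 Arho0).
  + rewrite (ae_ge0_integral_scale3 B0 mArho Arho0).
    have irho : (@leb3 R).-integrable setT (EFin \o rho_m).
      have [_ + _] := Lrho; apply: le_integrable => //.
        exact/measurable_EFinP.
      by move=> x _; rewrite /= normr_id.
    have [_ _ rhom] := rhoM.
    under [X in (_ * X)%E]eq_integral do rewrite EFinM.
    rewrite (integralZl measurableT irho) rhom -!EFinM; congr (_%:E).
    by rewrite mulrCA mass_exponent.
(* The internal energy of rho is A^gamma B^-3 times that of rho_m. *)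
- pose h x := K / (gamma - 1) * (A * rho_m x) `^ gamma.
  have mh : measurable_fun setT (EFin \o h).
    apply/measurable_EFinP; apply: measurable_funM => //.
    exact: measurableT_comp (measurable_powR _) mArho.
  have h0 x : (0 <= (EFin \o h) x)%E.
    by rewrite lee_fin mulr_ge0 ?powR_ge0// ltW.
  rewrite (_ : internal_energy _ _ _ =
    \int[@leb3 R]_x (EFin \o h) (scale3 B x))%E//.
  rewrite ge0_integral_scale3//.
  rewrite lte_mul_pinfty ?lee_fin ?invr_ge0 ?exprn_ge0 ?(ltW B0)//.
  have iU := internal_energy_integrable K0 g1 Lrho Urho.
  have := integrable_lty measurableT (integrableZl measurableT (A `^ gamma) iU).
  congr (_ < _)%E; apply: ae_eq_integral => //.
    exact: measurable_int (integrableZl measurableT (A `^ gamma) iU).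
  apply: filterS rho0 => x r0 _; rewrite -EFinM; congr (_%:E).
  by rewrite /h powRM ?(ltW A0)//; ring.
- apply: (filterS _ rho0) => x r0; rewrite /dE0.
  have -> : rho (scale3 B^-1 x) = A * rho_m x.
    congr (_ * rho_m _).
    by case: x {r0} => -[x1 x2] x3; rewrite /scale3/= !mulVKf ?gt_eqF.
  rewrite (potential_scale3 B0 x mrho rho0 (ltW A0)).
  rewrite muleBr//.
  rewrite muleA -!EFinM potential_exponent// mul1e; congr (_%:E - _)%E.
  rewrite powRM ?(ltW A0)//.
  have : A `^ (- (gamma - 1)) * A `^ (gamma - 1) = 1.
    by rewrite powRN mulVf// gt_eqF// powR_gt0.
  by move=> AA; rewrite mulrCA [X in _ = _ * X]mulrA AA mul1r.
- by apply: nearW => x; rewrite derivative_exponent.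
Qed.
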